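(* If $E$ is a graph and $R$ is a commutative ring with unit, then a $\mathbb{Z}$-grading on the Leavitt path algebra $L_R(E)$ is defined by setting, for $k\in\mathbb{Z}$, $$L_R(E)_k := \left\{ \sum_{i=1}^N \lambda_i \alpha_i \beta_i^* : \alpha_i, \beta_i \in E^*,\ \lambda_i \in R, \text{ and } |\alpha_i| - |\beta_i| = k \text{ for all } i \right\}.$$
   Context: Graphs: a graph is a directed graph $E=(E^0,E^1,r,s)$ with countable sets $E^0$ (vertices), $E^1$ (edges) and maps $r,s:E^1\to E^0$ (range, source). A vertex $v$ is regular, $v\in E^0_{\mathrm{reg}}$, if $0<|s^{-1}(v)|<\infty$. A path of length $n\ge 1$ is $\alpha=e_1\cdots e_n$ with $e_i\in E^1$ and $r(e_i)=s(e_{i+1})$; put $|\alpha|=n$, $s(\alpha)=s(e_1)$, $r(\alpha)=r(e_n)$. Vertices are paths of length $0$. $E^*$ is the set of all finite paths. For formal symbols $e^*$ ($e\in E^1$) put $\alpha^*:=e_n^*\cdots e_1^*$ and $v^*:=v$. Rings are not assumed commutative or unital. For $R$ a commutative ring with unit $1$, an $R$-algebra is a ring $A$ that is also a left $R$-module with $\lambda(xy)=(\lambda x)y=x(\lambda y)$ and $1\cdot x=x$; homomorphisms of $R$-algebras are $R$-linear ring homomorphisms. A Leavitt $E$-family in a ring is a collection $\{v,e,e^*:v\in E^0,e\in E^1\}$ of elements such that the $v$'s are pairwise orthogonal idempotents and: (1) $s(e)e=er(e)=e$; (2) $r(e)e^*=e^*s(e)=e^*$; (3) $e^*f=\delta_{e,f}\,r(e)$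 for all $e,f\in E^1$; (4) $v=\sum_{s(e)=v}ee^*$ for every $v\in E^0_{\mathrm{reg}}$. The Leavitt path algebra $L_R(E)$ is the universal $R$-algebra generated by a Leavitt $E$-family $\{v,e,e^*\}$: every Leavitt $E$-family $\{a_v,b_e,c_{e^*}\}$ in an $R$-algebra $A$ is the image of the generators under an $R$-algebra homomorphism $L_R(E)\to A$ with $v\mapsto a_v$, $e\mapsto b_e$, $e^*\mapsto c_{e^*}$. Paths and ghost paths $\alpha,\alpha^*$ are regarded as the corresponding products in $L_R(E)$. A $\mathbb{Z}$-grading on a ring $T$ is a collection of additive subgroups $\{T_k\}_{k\in\mathbb{Z}}$ with $T=\bigoplus_{k\in\mathbb{Z}}T_k$ and $T_jT_k\subseteq T_{j+k}$ for all $j,k\in\mathbb{Z}$. *)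

(* Defs.v *)
From HB Require Import structures.
From mathcomp Require Import all_boot all_order all_algebra generic_quotient.
From mathcomp Require Import finmap boolp classical_sets functions.
From mathcomp Require Import cardinality fsbigop.

Set Implicit Arguments.
Unset Strict Implicit.
Unset Printing Implicit Defensive.

Import GRing.Theory.
Local Open Scope classical_set_scope.
Local Open Scope ring_scope.

Reserved Notation "x ** y" (at level 40, left associativity).

(* MathComp rings and algebras have a unit; the rings and algebras here need
   not be unital nor commutative. *)
HB.mixin Record Zmodule_isNonUnitalRing A of GRing.Zmodule A := {
  numul : A -> A -> A;
  numulA : associative numul;
  numulDl : left_distributive numul +%R;
  numulDr : right_distributive numul +%R
}.

#[short(type="nonUnitalRingType")]
HB.structure Definition NonUnitalRing :=
  {A of GRing.Zmodule A & Zmodule_isNonUnitalRing A}.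

Notation "x ** y" := (numul x y) : ring_scope.

HB.mixin Record NonUnitalRing_isNonUnitalAlgebra (R : comPzRingType) A
    of NonUnitalRing A & GRing.Lmodule R A := {
  nuscalerAl : forall (l : R) (x y : A), l *: (x ** y) = (l *: x) ** y;
  nuscalerAr : forall (l : R) (x y : A), l *: (x ** y) = x ** (l *: y)
}.

#[short(type="nonUnitalAlgType")]
HB.structure Definition NonUnitalAlgebra (R : comPzRingType) :=
  {A of NonUnitalRing A & GRing.Lmodule R A
      & NonUnitalRing_isNonUnitalAlgebra R A}.

Record graph := Graph {
  vertex : countType;
  edge : countType;
  esource : edge -> vertex;
  erange : edge -> vertex
}.

Definition regular_vertex (E : graph) (v : vertex E) : Prop :=
  let out := [set e | esource e = v] in out !=set0 /\ finite_set out.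

Inductive gpath (E : graph) : Type :=
| VertexPath of vertex E
| EdgePath (e : edge E) (es : seq (edge E)) of
    path (fun f g => erange f == esource g) e es.

Definition gpath_length (E : graph) (p : gpath E) : nat :=
  match p with
  | VertexPath _ => 0
  | EdgePath _ es _ => (size es).+1
  end.

Record gen_family (E : graph) (A : Type) := Family {
  fam_v : vertex E -> A;
  fam_e : edge E -> A;
  fam_g : edge E -> A   (* the elements e^* *)
}.

Record is_leavitt_family (E : graph) (A : nonUnitalRingType)
    (F : gen_family E A) : Prop := {
  leavitt_vv : forall v w : vertex E,
    fam_v F v ** fam_v F w = if v == w then fam_v F v else 0;
  leavitt_se : forall e : edge E, fam_v F (esource e) ** fam_e F e = fam_e F e;
  leavitt_er : forall e : edge E, fam_e F e ** fam_v F (erange e) = fam_e F e;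
  leavitt_rg : forall e : edge E, fam_v F (erange e) ** fam_g F e = fam_g F e;
  leavitt_gs : forall e : edge E, fam_g F e ** fam_v F (esource e) = fam_g F e;
  leavitt_ge : forall e f : edge E,
    fam_g F e ** fam_e F f = if e == f then fam_v F (erange e) else 0;
  leavitt_reg : forall v : vertex E, regular_vertex v ->
    fam_v F v = \sum_(e \in [set e | esource e = v]) fam_e F e ** fam_g F e
}.

(* The path e1 e2 ... en is sent to e1 ** e2 ** ... ** en. *)
Definition path_elt (E : graph) (A : nonUnitalRingType) (F : gen_family E A)
    (p : gpath E) : A :=
  match p with
  | VertexPath v => fam_v F v
  | EdgePath e es _ => foldl (fun x f => x ** fam_e F f) (fam_e F e) es
  end.

(* The path e1 e2 ... en is sent to en^* ** ... ** e2^* ** e1^*. *)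
Definition ghost_elt (E : graph) (A : nonUnitalRingType) (F : gen_family E A)
    (p : gpath E) : A :=
  match p with
  | VertexPath v => fam_v F v
  | EdgePath e es _ => foldl (fun x f => fam_g F f ** x) (fam_g F e) es
  end.

Definition is_subalgebra (R : comPzRingType) (A : nonUnitalAlgType R)
    (S : set A) : Prop :=
  [/\ S 0,
      forall x y, S x -> S y -> S (x - y),
      forall (l : R) x, S x -> S (l *: x)
    & forall x y, S x -> S y -> S (x ** y)].

Definition generated_by (R : comPzRingType) (E : graph)
    (A : nonUnitalAlgType R) (F : gen_family E A) : Prop :=
  forall S : set A, is_subalgebra S ->
    (forall v, S (fam_v F v)) ->
    (forall e, S (fam_e F e)) ->
    (forall e, S (fam_g F e)) ->
    S = setT.

Record is_leavitt_path_algebra (R : comPzRingType) (E : graph)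
    (L : nonUnitalAlgType R) (F : gen_family E L) : Prop := {
  lpa_family : is_leavitt_family F;
  lpa_generated : generated_by F;
  lpa_universal : forall (A : nonUnitalAlgType R) (G : gen_family E A),
    is_leavitt_family G ->
    exists phi : {linear L -> A},
      [/\ forall x y, phi (x ** y) = phi x ** phi y,
          forall v, phi (fam_v F v) = fam_v G v,
          forall e, phi (fam_e F e) = fam_e G e
        & forall e, phi (fam_g F e) = fam_g G e]
}.

(* T is the internal direct sum of the T_k: every element is in exactly one
   way a finite sum of elements x_k of T_k. *)
Record is_Zgrading (A : nonUnitalRingType) (T : int -> set A) : Prop := {
  Zgrading_subgroup : forall k,
    T k 0 /\ (forall x y, T k x -> T k y -> T k (x - y));
  Zgrading_direct_sum : forall x : A,
    exists! x_ : int -> A,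
      [/\ forall k, T k (x_ k),
          finite_set [set k | x_ k != 0]
        & x = \sum_(k \in [set: int]) x_ k];
  Zgrading_mul : forall (j k : int) (x y : A),
    T j x -> T k y -> T (j + k) (x ** y)
}.

(* The sum may be empty: N = 0 is allowed. *)
Definition leavitt_component (R : comPzRingType) (E : graph)
    (L : nonUnitalAlgType R) (F : gen_family E L) (k : int) : set L :=
  [set x | exists (N : nat) (l : 'I_N -> R) (a b : 'I_N -> gpath E),
     (forall i, (gpath_length (a i))%:Z - (gpath_length (b i))%:Z = k) /\
     x = \sum_(i < N) l i *: (path_elt F (a i) ** ghost_elt F (b i))].

(* Existence of L_R(E): formal expressions in the generators, modulo the
   congruence generated by the algebra axioms and the Leavitt relations. *)
Module LpaExistence.
Section Existence.
Variables (R : comPzRingType) (E : graph).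

Inductive lterm : Type :=
| Tv of vertex E | Te of edge E | Tg of edge E
| T0 | Tadd of lterm & lterm | Topp of lterm
| Tscale of R & lterm | Tmul of lterm & lterm.

HB.instance Definition _ := gen_eqMixin lterm.
HB.instance Definition _ := gen_choiceMixin lterm.

Definition Tsum (v : vertex E) : lterm :=
  \big[Tadd/T0]_(e <- fset_set [set e | esource e = v]) Tmul (Te e) (Tg e).

Inductive lcong : lterm -> lterm -> Prop :=
| cong_refl x : lcong x x
| cong_sym x y : lcong x y -> lcong y x
| cong_trans x y z : lcong x y -> lcong y z -> lcong x z
| cong_add x x' y y' : lcong x x' -> lcong y y' ->
    lcong (Tadd x y) (Tadd x' y')
| cong_opp x x' : lcong x x' -> lcong (Topp x) (Topp x')
| cong_scale l x x' : lcong x x' -> lcong (Tscale l x) (Tscale l x')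
| cong_mul x x' y y' : lcong x x' -> lcong y y' ->
    lcong (Tmul x y) (Tmul x' y')
| cong_addA x y z : lcong (Tadd x (Tadd y z)) (Tadd (Tadd x y) z)
| cong_addC x y : lcong (Tadd x y) (Tadd y x)
| cong_add0 x : lcong (Tadd T0 x) x
| cong_addN x : lcong (Tadd (Topp x) x) T0
| cong_mulA x y z : lcong (Tmul x (Tmul y z)) (Tmul (Tmul x y) z)
| cong_mulDl x y z :
    lcong (Tmul (Tadd x y) z) (Tadd (Tmul x z) (Tmul y z))
| cong_mulDr x y z :
    lcong (Tmul x (Tadd y z)) (Tadd (Tmul x y) (Tmul x z))
| cong_scaleA k l x : lcong (Tscale k (Tscale l x)) (Tscale (k * l) x)
| cong_scale1 x : lcong (Tscale 1 x) x
| cong_scaleDr k x y :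
    lcong (Tscale k (Tadd x y)) (Tadd (Tscale k x) (Tscale k y))
| cong_scaleDl k l x :
    lcong (Tscale (k + l) x) (Tadd (Tscale k x) (Tscale l x))
| cong_scaleAl k x y : lcong (Tscale k (Tmul x y)) (Tmul (Tscale k x) y)
| cong_scaleAr k x y : lcong (Tscale k (Tmul x y)) (Tmul x (Tscale k y))
| cong_vv v w : lcong (Tmul (Tv v) (Tv w)) (if v == w then Tv v else T0)
| cong_se e : lcong (Tmul (Tv (esource e)) (Te e)) (Te e)
| cong_er e : lcong (Tmul (Te e) (Tv (erange e))) (Te e)
| cong_rg e : lcong (Tmul (Tv (erange e)) (Tg e)) (Tg e)
| cong_gs e : lcong (Tmul (Tg e) (Tv (esource e))) (Tg e)
| cong_ge e f :
    lcong (Tmul (Tg e) (Te f)) (if e == f then Tv (erange e) else T0)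
| cong_reg v : regular_vertex v -> lcong (Tv v) (Tsum v).

Definition lcongb (x y : lterm) : bool := `[< lcong x y >].

Lemma lcongb_refl : reflexive lcongb.
Proof. by move=> x; apply/asboolP; exact: cong_refl. Qed.

Lemma lcongb_sym : symmetric lcongb.
Proof. by move=> x y; apply/asboolP/asboolP; exact: cong_sym. Qed.

Lemma lcongb_trans : transitive lcongb.
Proof.
move=> y x z /asboolP xy /asboolP yz.
by apply/asboolP; exact: cong_trans xy yz.
Qed.

Canonical lcong_equiv := EquivRel lcongb lcongb_refl lcongb_sym lcongb_trans.

Definition lpa := {eq_quot lcong_equiv}%qT.
HB.instance Definition _ := Choice.on lpa.

Definition cls (x : lterm) : lpa := (\pi_({eq_quot lcong_equiv}) x)%qT.
Definition rep (x : lpa) : lterm := repr x.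

Lemma clsP x y : lcong x y -> cls x = cls y.
Proof. by move=> xy; apply/eqmodP/asboolP. Qed.

Lemma cls_inj x y : cls x = cls y -> lcong x y.
Proof. by move/eqmodP/asboolP. Qed.

Lemma repK x : cls (rep x) = x.
Proof. exact: reprK. Qed.

Lemma clsK x : lcong (rep (cls x)) x.
Proof. by apply: cls_inj; rewrite repK. Qed.

Lemma cls_ind (P : lpa -> Prop) : (forall x, P (cls x)) -> forall x, P x.
Proof. by move=> h x; rewrite -(repK x). Qed.

Definition ladd (x y : lpa) := cls (Tadd (rep x) (rep y)).
Definition lopp (x : lpa) := cls (Topp (rep x)).
Definition lscale (l : R) (x : lpa) := cls (Tscale l (rep x)).
Definition lmul (x y : lpa) := cls (Tmul (rep x) (rep y)).

Lemma laddE x y : ladd (cls x) (cls y) = cls (Tadd x y).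
Proof. by apply: clsP; apply: cong_add; apply: clsK. Qed.
Lemma loppE x : lopp (cls x) = cls (Topp x).
Proof. by apply: clsP; apply: cong_opp; apply: clsK. Qed.
Lemma lscaleE l x : lscale l (cls x) = cls (Tscale l x).
Proof. by apply: clsP; apply: cong_scale; apply: clsK. Qed.
Lemma lmulE x y : lmul (cls x) (cls y) = cls (Tmul x y).
Proof. by apply: clsP; apply: cong_mul; apply: clsK. Qed.
Definition lE := (laddE, loppE, lscaleE, lmulE).

Lemma laddA : associative ladd.
Proof.
by elim/cls_ind=> x; elim/cls_ind=> y; elim/cls_ind=> z; rewrite !lE;
  apply: clsP; constructor.
Qed.
Lemma laddC : commutative ladd.
Proof.
by elim/cls_ind=> x; elim/cls_ind=> y; rewrite !lE; apply: clsP; constructor.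
Qed.
Lemma ladd0 : left_id (cls T0) ladd.
Proof. by elim/cls_ind=> x; rewrite !lE; apply: clsP; constructor. Qed.
Lemma laddN : left_inverse (cls T0) lopp ladd.
Proof. by elim/cls_ind=> x; rewrite !lE; apply: clsP; constructor. Qed.

HB.instance Definition _ := GRing.isZmodule.Build lpa laddA laddC ladd0 laddN.

Lemma lmulA : associative lmul.
Proof.
by elim/cls_ind=> x; elim/cls_ind=> y; elim/cls_ind=> z; rewrite !lE;
  apply: clsP; constructor.
Qed.
Lemma lmulDl : left_distributive lmul ladd.
Proof.
by elim/cls_ind=> x; elim/cls_ind=> y; elim/cls_ind=> z; rewrite !lE;
  apply: clsP; constructor.
Qed.
Lemma lmulDr : right_distributive lmul ladd.
Proof.
by elim/cls_ind=> x; elim/cls_ind=> y; elim/cls_ind=> z; rewrite !lE;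
  apply: clsP; constructor.
Qed.

HB.instance Definition _ :=
  Zmodule_isNonUnitalRing.Build lpa lmulA lmulDl lmulDr.

Lemma lscaleA k l x : lscale k (lscale l x) = lscale (k * l) x.
Proof. by elim/cls_ind: x => x; rewrite !lE; apply: clsP; constructor. Qed.
Lemma lscale1 : left_id 1 lscale.
Proof. by elim/cls_ind=> x; rewrite !lE; apply: clsP; constructor. Qed.
Lemma lscaleDr : right_distributive lscale +%R.
Proof.
move=> k; elim/cls_ind=> x; elim/cls_ind=> y.
change (lscale k (ladd (cls x) (cls y)) =
  ladd (lscale k (cls x)) (lscale k (cls y))).
by rewrite !lE; apply: clsP; constructor.
Qed.
Lemma lscaleDl x : {morph lscale^~ x : k l / k + l}.
Proof.
move=> k l; elim/cls_ind: x => x.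
change (lscale (k + l) (cls x) = ladd (lscale k (cls x)) (lscale l (cls x))).
by rewrite !lE; apply: clsP; constructor.
Qed.

HB.instance Definition _ :=
  GRing.Zmodule_isLmodule.Build R lpa lscaleA lscale1 lscaleDr lscaleDl.

Lemma lscaleAl (l : R) (x y : lpa) : l *: (x ** y) = (l *: x) ** y.
Proof.
elim/cls_ind: x => x; elim/cls_ind: y => y.
change (lscale l (lmul (cls x) (cls y)) = lmul (lscale l (cls x)) (cls y)).
by rewrite !lE; apply: clsP; constructor.
Qed.
Lemma lscaleAr (l : R) (x y : lpa) : l *: (x ** y) = x ** (l *: y).
Proof.
elim/cls_ind: x => x; elim/cls_ind: y => y.
change (lscale l (lmul (cls x) (cls y)) = lmul (cls x) (lscale l (cls y))).
by rewrite !lE; apply: clsP; constructor.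
Qed.

HB.instance Definition _ :=
  NonUnitalRing_isNonUnitalAlgebra.Build R lpa lscaleAl lscaleAr.

Definition lpa_fam : gen_family E lpa :=
  Family (fun v => cls (Tv v)) (fun e => cls (Te e)) (fun e => cls (Tg e)).

Lemma lpa_fam_leavitt : is_leavitt_family lpa_fam.
Proof.
split=> /=.
- move=> v w; rewrite [LHS]lmulE; have -> := clsP (cong_vv v w).
  by case: ifP.
- by move=> e; rewrite [LHS]lmulE; apply: clsP; constructor.
- by move=> e; rewrite [LHS]lmulE; apply: clsP; constructor.
- by move=> e; rewrite [LHS]lmulE; apply: clsP; constructor.
- by move=> e; rewrite [LHS]lmulE; apply: clsP; constructor.
- move=> e f; rewrite [LHS]lmulE; have -> := clsP (cong_ge e f).
  by case: ifP.
- move=> v vreg; have [_ vfin] := vreg.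
  rewrite fsbig_finite//= (clsP (cong_reg vreg)) /Tsum.
  elim: (enum_fset _) => [|e s ih]; first by rewrite !big_nil.
  by rewrite !big_cons -ih /= [_ ** _]lmulE [RHS]laddE.
Qed.

Section Eval.
Variables (A : nonUnitalAlgType R) (G : gen_family E A).
Hypothesis HG : is_leavitt_family G.

Fixpoint leval (t : lterm) : A :=
  match t with
  | Tv v => fam_v G v
  | Te e => fam_e G e
  | Tg e => fam_g G e
  | T0 => 0
  | Tadd x y => leval x + leval y
  | Topp x => - leval x
  | Tscale l x => l *: leval x
  | Tmul x y => leval x ** leval y
  end.

Lemma leval_cong x y : lcong x y -> leval x = leval y.
Proof.
elim=> //=; try by move=> *; congruence.
- by move=> *; rewrite addrA.
- by move=> *; rewrite addrC.
- by move=> *; rewrite add0r.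
- by move=> *; rewrite addNr.
- by move=> *; rewrite numulA.
- by move=> *; rewrite numulDl.
- by move=> *; rewrite numulDr.
- by move=> *; rewrite scalerA.
- by move=> *; rewrite scale1r.
- by move=> *; rewrite scalerDr.
- by move=> *; rewrite scalerDl.
- by move=> *; rewrite nuscalerAl.
- by move=> *; rewrite nuscalerAr.
- by move=> v w; rewrite (leavitt_vv HG); case: ifP.
- by move=> e; exact: leavitt_se.
- by move=> e; exact: leavitt_er.
- by move=> e; exact: leavitt_rg.
- by move=> e; exact: leavitt_gs.
- by move=> e f; rewrite (leavitt_ge HG); case: ifP.
- move=> v vreg; have [_ vfin] := vreg.
  rewrite (leavitt_reg HG vreg) fsbig_finite//= /Tsum.
  elim: (enum_fset _) => [|e s ih]; first by rewrite !big_nil.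
  by rewrite !big_cons ih.
Qed.

Definition lphi (x : lpa) : A := leval (rep x).

Lemma lphiE t : lphi (cls t) = leval t.
Proof. exact: leval_cong (clsK t). Qed.

Lemma lphi_linear : linear lphi.
Proof.
move=> l; elim/cls_ind=> x; elim/cls_ind=> y.
have -> : l *: cls x + cls y = cls (Tadd (Tscale l x) y).
  by rewrite -laddE -lscaleE.
by rewrite !lphiE.
Qed.

HB.instance Definition _ := GRing.isLinear.Build R lpa A *:%R lphi lphi_linear.
Definition lphi_lin : {linear lpa -> A} := lphi.

Lemma lphiM x y : lphi (x ** y) = lphi x ** lphi y.
Proof.
elim/cls_ind: x => x; elim/cls_ind: y => y.
by rewrite [cls x ** _]lmulE !lphiE.
Qed.

End Eval.

Lemma lpa_fam_generated : generated_by lpa_fam.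
Proof.
move=> S [S0 SB SZ SM] Sv Se Sg; apply/seteqP; split=> // x _.
have SN z : S z -> S (- z) by move=> Sz; rewrite -[- z]add0r; exact: SB.
elim/cls_ind: x; elim=> //.
- by move=> x Sx y Sy; rewrite -laddE -[cls y]opprK; apply: SB => //; exact: SN.
- by move=> x Sx; rewrite -loppE; exact: SN.
- by move=> l x Sx; rewrite -lscaleE; exact: SZ.
- by move=> x Sx y Sy; rewrite -lmulE; exact: SM.
Qed.

Lemma leavitt_path_algebra_exists :
  exists (L : nonUnitalAlgType R) (F : gen_family E L),
    is_leavitt_path_algebra F.
Proof.
exists lpa, lpa_fam; split.
- exact: lpa_fam_leavitt.
- exact: lpa_fam_generated.
- move=> A G HG; exists (lphi_lin HG).
  by split=> [x y|v|e|e]; [exact: lphiM|exact: lphiE|exact: lphiE|exact: lphiE].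
Qed.

End Existence.
End LpaExistence.

(* Main.v *)
Require Import Defs.
From HB Require Import structures.
From mathcomp Require Import all_boot all_order all_algebra.
From mathcomp Require Import boolp classical_sets functions cardinality fsbigop.

Set Implicit Arguments.
Unset Strict Implicit.
Unset Printing Implicit Defensive.

Import GRing.Theory.
Local Open Scope classical_set_scope.
Local Open Scope ring_scope.

(** Write [T k] for [leavitt_component F k].  That the [T k] multiply as they
    should and span [L] follows from the relations alone; that their sum is
    direct needs the universal property.

    Multiplication by an element [x] of degree [d] acts on the two-sided
    sequences [f : int -> L] by [n |-> x ** f (n - d)]; this is the Laurent
    monomial [x t^d] acting on doubly infinite formal series in [t] over [L],
    and [x t^d] composed with [y t^d'] is [x y t^(d + d')] ([laurentM]).  So
    [v t^0], [e t], [e^* t^-1] form a Leavitt family in the algebra of linear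
    endomorphisms of [int -> L] ([laurent_family]), and the universal property
    gives a homomorphism [phi] into that algebra.  It sends every [x] in [T k]
    to [x t^k].  If [x] is a finite sum of [x_ k] in [T k], evaluating [phi x]
    at the sequence concentrated in degree [0] with value a vertex [v] recovers
    [x_ n ** v] in degree [n] ([decomposition_coefficient]).  Every element of
    [L] has a finite sum of vertices as a right unit, so the elements
    [x_ n ** v], for [v] a vertex, determine [x_ n] ([vertices_faithful]).

    The other two points rest on one principle ([component_min]): the [T k]
    form the smallest family of submodules indexed by degrees which is closed
    under graded products and contains the generators in their degrees.
    Applied to the elements that shift the components by [d] under left
    multiplication, it reduces [T j ** T k <= T (j + k)] to left multiplication
    of [alpha beta^*] by one generator.  It also yields the formula for [phi]
    on [T k].  Finally the additive span of the components is then a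
    subalgebra containing the generators, hence all of [L]
    ([components_span]). *)

(** * Rings without unit and finitely supported sums *)

Lemma numul0r (A : nonUnitalRingType) (x : A) : 0 ** x = 0.
Proof. by apply: (addrI (0 ** x)); rewrite -numulDl !addr0. Qed.

Lemma numulr0 (A : nonUnitalRingType) (x : A) : x ** 0 = 0.
Proof. by apply: (addrI (x ** 0)); rewrite -numulDr !addr0. Qed.

Lemma numulNr (A : nonUnitalRingType) (x y : A) : (- x) ** y = - (x ** y).
Proof. by apply: (addrI (x ** y)); rewrite -numulDl !subrr numul0r. Qed.

Lemma numulrN (A : nonUnitalRingType) (x y : A) : x ** (- y) = - (x ** y).
Proof. by apply: (addrI (x ** y)); rewrite -numulDr !subrr numulr0. Qed.

Lemma numulBl (A : nonUnitalRingType) (x y z : A) :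
  (x - y) ** z = x ** z - y ** z.
Proof. by rewrite numulDl numulNr. Qed.

Lemma numulBr (A : nonUnitalRingType) (x y z : A) :
  z ** (x - y) = z ** x - z ** y.
Proof. by rewrite numulDr numulrN. Qed.

Lemma numul_sumr (A : nonUnitalRingType) (I : Type) (r : seq I) (x : A)
    (f : I -> A) : x ** (\sum_(i <- r) f i) = \sum_(i <- r) x ** f i.
Proof. exact: (big_morph _ (numulDr x) (numulr0 x)). Qed.

Lemma finite_support_of_seq (I : choiceType) (V : zmodType) (x_ : I -> V)
    (r : seq I) :
  (forall k, k \notin r -> x_ k = 0) -> finite_set [set k | x_ k != 0].
Proof.
move=> xr; apply: (@sub_finite_set _ _ [set` r]); last exact: finite_seq.
by move=> k /=; apply: contraNT => /xr ->.
Qed.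

Lemma seq_of_finite_support (I : choiceType) (V : zmodType) (x_ : I -> V) :
  finite_set [set k | x_ k != 0] ->
  exists r : seq I, forall k, k \notin r -> x_ k = 0.
Proof.
move=> /finite_seqP[r xr]; exists r => k; apply: contraNeq => xk.
by have : [set k | x_ k != 0] k by []; rewrite xr.
Qed.

Lemma fsum_seq (I : choiceType) (V : zmodType) (x_ : I -> V) (r : seq I) :
  uniq r -> (forall k, k \notin r -> x_ k = 0) ->
  \sum_(k \in [set: I]) x_ k = \sum_(k <- r) x_ k.
Proof.
move=> ur xr; rewrite (fsbigE r)// => [|k _ /xr//].
by apply: eq_bigl => k; rewrite in_setT.
Qed.

(** * The algebra of linear endomorphisms of a module *)

Section Endo.
Variables (R : comPzRingType) (M : lmodType R).

Definition linear_pred : {pred M -> M} := fun f => `[< linear f >].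

Lemma linear_pred_closed : submod_closed linear_pred.
Proof.
split=> [|l f g /asboolP lf /asboolP lg]; apply/asboolP => k x y.
  by rewrite /= scaler0 addr0.
rewrite !fctE lf lg !scalerDr !scalerA addrACA.
by rewrite (mulrC l).
Qed.

HB.instance Definition _ :=
  GRing.isSubmodClosed.Build R (M -> M) linear_pred linear_pred_closed.

(** A subtype of all functions, so that it inherits their pointwise module
    structure. *)
Record endo := Endo { endo_fun :> M -> M; _ : endo_fun \in linear_pred }.

HB.instance Definition _ := [isSub for endo_fun].
HB.instance Definition _ := gen_eqMixin endo.
HB.instance Definition _ := gen_choiceMixin endo.
HB.instance Definition _ := [SubChoice_isSubLmodule of endo by <:].

Lemma endo_linear (f : endo) : linear f.
Proof. by case: f => f fP; exact/asboolP. Qed.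

Lemma endoP (f g : endo) : (forall x, f x = g x) -> f = g.
Proof. by move=> fg; apply/val_inj/funext. Qed.

Lemma endoD (f : endo) x y : f (x + y) = f x + f y.
Proof. by have := endo_linear f 1 x y; rewrite !scale1r. Qed.

Lemma endo0 (f : endo) : f 0 = 0.
Proof. by apply: (addrI (f 0)); rewrite -endoD !addr0. Qed.

Lemma endoZ (f : endo) l x : f (l *: x) = l *: f x.
Proof. by have := endo_linear f l x 0; rewrite endo0 !addr0. Qed.

Lemma endo_comp_subproof (f g : endo) : f \o g \in linear_pred.
Proof. by apply/asboolP => l x y /=; rewrite !endo_linear. Qed.

Definition endo_comp f g : endo := Endo (endo_comp_subproof f g).

Lemma endo_compA : associative endo_comp.
Proof. by move=> f g h; apply: endoP. Qed.

Lemma endo_compDl : left_distributive endo_comp +%R.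
Proof. by move=> f g h; apply: endoP. Qed.

Lemma endo_compDr : right_distributive endo_comp +%R.
Proof. by move=> f g h; apply: endoP => x /=; exact: endoD. Qed.

HB.instance Definition _ :=
  Zmodule_isNonUnitalRing.Build endo endo_compA endo_compDl endo_compDr.

Lemma endo_scaleAl (l : R) (f g : endo) : l *: (f ** g) = (l *: f) ** g.
Proof. by apply: endoP. Qed.

Lemma endo_scaleAr (l : R) (f g : endo) : l *: (f ** g) = f ** (l *: g).
Proof. by apply: endoP => x; exact/esym/endoZ. Qed.

HB.instance Definition _ :=
  NonUnitalRing_isNonUnitalAlgebra.Build R endo endo_scaleAl endo_scaleAr.

End Endo.

(** * Laurent monomials as operators on two-sided sequences *)

Section Laurent.
Variables (R : comPzRingType) (L : nonUnitalAlgType R).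

Lemma laurent_linear (x : L) (d : int) :
  (fun (f : int -> L) n => x ** f (n - d)) \in @linear_pred R (int -> L).
Proof.
apply/asboolP => l f g; apply/funext => n.
by rewrite /= !fctE numulDr nuscalerAr.
Qed.

(** The monomial [x t^d], acting by left multiplication on the doubly infinite
    series whose coefficient of degree [n] is [f n]. *)
Definition laurent (x : L) (d : int) : endo (int -> L) :=
  Endo (laurent_linear x d).

Lemma laurentM x y d d' :
  laurent x d ** laurent y d' = laurent (x ** y) (d + d').
Proof.
apply: endoP => f; apply/funext => n /=.
by rewrite numulA opprD addrA.
Qed.

Lemma laurentD x y d : laurent (x + y) d = laurent x d + laurent y d.
Proof. by apply: endoP => f; apply/funext => n /=; rewrite numulDl. Qed.

Lemma laurent0 d : laurent 0 d = 0.
Proof. by apply: endoP => f; apply/funext => n /=; rewrite numul0r. Qed.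

Lemma laurentZ l x d : laurent (l *: x) d = l *: laurent x d.
Proof. by apply: endoP => f; apply/funext => n /=; rewrite -nuscalerAl. Qed.

Lemma laurent_sum (r : seq int) (x_ : int -> L) f n :
  (\sum_(k <- r) laurent (x_ k) k) f n = \sum_(k <- r) x_ k ** f (n - k).
Proof.
elim: r => [|k r IH]; first by rewrite !big_nil.
by rewrite !big_cons -IH.
Qed.

(** Every relation of a Leavitt family is homogeneous when vertices, edges and
    ghost edges have degrees [0], [1] and [-1], so the powers of [t] agree on
    both sides of each relation. *)
Lemma laurent_family (E : graph) (F : gen_family E L) :
  is_leavitt_family F ->
  is_leavitt_family (Family (fun v => laurent (fam_v F v) 0)
    (fun e => laurent (fam_e F e) 1) (fun e => laurent (fam_g F e) (- 1))).
Proof.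
move=> HF; split=> /=.
- move=> v w; rewrite laurentM addr0 (leavitt_vv HF).
  by case: ifP => // _; rewrite laurent0.
- by move=> e; rewrite laurentM add0r leavitt_se.
- by move=> e; rewrite laurentM addr0 leavitt_er.
- by move=> e; rewrite laurentM add0r leavitt_rg.
- by move=> e; rewrite laurentM addr0 leavitt_gs.
- move=> e f; rewrite laurentM addNr (leavitt_ge HF).
  by case: ifP => // _; rewrite laurent0.
- move=> v vreg; have [_ vfin] := vreg.
  rewrite (leavitt_reg HF vreg) !fsbig_finite//=.
  rewrite (big_morph (laurent^~ 0) (fun x y => laurentD x y 0) (laurent0 0)).
  by apply: eq_bigr => e _; rewrite laurentM subrr.
Qed.

End Laurent.

(** * Left multiplication of paths by generators *)

Section LeavittPathAlgebra.
Variables (R : comPzRingType) (E : graph) (L : nonUnitalAlgType R).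
Variables (F : gen_family E L) (HF : is_leavitt_family F).

Definition gpath_source (p : gpath E) : vertex E :=
  match p with VertexPath v => v | EdgePath e _ _ => esource e end.

Definition gpath_range (p : gpath E) : vertex E :=
  match p with VertexPath v => v | EdgePath e es _ => erange (last e es) end.

Lemma edges_mulA (x y : L) es :
  foldl (fun z f => z ** fam_e F f) (x ** y) es =
  x ** foldl (fun z f => z ** fam_e F f) y es.
Proof. by elim: es y => //= f es IH y; rewrite -numulA IH. Qed.

Lemma source_mul_path p :
  fam_v F (gpath_source p) ** path_elt F p = path_elt F p.
Proof.
case: p => [v|e es ?] /=; first by rewrite (leavitt_vv HF) eqxx.
by rewrite -edges_mulA leavitt_se.
Qed.

Lemma range_mul_ghost p :
  fam_v F (gpath_range p) ** ghost_elt F p = ghost_elt F p.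
Proof.
case: p => [v|e es pes] /=; first by rewrite (leavitt_vv HF) eqxx.
case/lastP: es {pes} => [|es f] /=; first by rewrite leavitt_rg.
by rewrite last_rcons foldl_rcons numulA leavitt_rg.
Qed.

Lemma vertex_mul v w (x : L) : fam_v F w ** x = x ->
  fam_v F v ** x = if v == w then x else 0.
Proof.
move=> wx; rewrite -wx numulA (leavitt_vv HF).
by case: eqP => [->|_] //; rewrite numul0r.
Qed.

(** Since [e = e r(e)], the product vanishes unless [e] followed by [p] is a
    path, which is then [q]. *)
Lemma edge_mul_path e p : fam_e F e ** path_elt F p = 0 \/
  exists2 q, gpath_length q = (gpath_length p).+1 &
    fam_e F e ** path_elt F p = path_elt F q.
Proof.
rewrite -(leavitt_er HF) -numulA (vertex_mul _ (source_mul_path p)).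
case: eqP => [ep|_]; last by left; rewrite numulr0.
right; case: p ep => [v|f es pes] /= ep.
  by exists (@EdgePath E e [::] isT) => //=; rewrite -ep leavitt_er.
have pes' : path (fun f g => erange f == esource g) e (f :: es).
  by rewrite /= ep eqxx.
by exists (EdgePath pes') => //=; rewrite edges_mulA.
Qed.

(** Since [e^* = e^* s(e)], the product vanishes unless [p] followed by [e] is
    a path, and then [e^* p^*] is the ghost of that path. *)
Lemma ghost_mul_ghost e p : fam_g F e ** ghost_elt F p = 0 \/
  exists2 q, gpath_length q = (gpath_length p).+1 &
    fam_g F e ** ghost_elt F p = ghost_elt F q.
Proof.
rewrite -(leavitt_gs HF) -numulA (vertex_mul _ (range_mul_ghost p)).
case: eqP => [ep|_]; last by left; rewrite numulr0.
right; case: p ep => [v|f es pes] /= ep.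
  by exists (@EdgePath E e [::] isT) => //=; rewrite -ep leavitt_gs.
have pes' : path (fun f g => erange f == esource g) f (rcons es e).
  by rewrite rcons_path pes ep eqxx.
by exists (EdgePath pes'); rewrite /= ?size_rcons ?foldl_rcons.
Qed.

(** The ghost edge either kills [p] or strips its first edge; when [p] is a
    vertex there is nothing to strip and [e^*] itself remains. *)
Lemma ghost_mul_path e p : fam_g F e ** path_elt F p = 0 \/
  fam_g F e ** path_elt F p = fam_g F e /\ gpath_length p = 0 \/
  exists2 q, gpath_length p = (gpath_length q).+1 &
    fam_g F e ** path_elt F p = path_elt F q.
Proof.
case: p => [v|f es pes] /=.
  rewrite -(leavitt_gs HF) -numulA (leavitt_vv HF).
  case: eqP => [ev|_]; last by left; rewrite numulr0.
  by right; left; split.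
rewrite -edges_mulA (leavitt_ge HF).
case: eqP => [->|_]; last first.
  by left; elim: (es) => //= g gs; rewrite numul0r.
right; right; case: es pes => [|g es] /=.
  by exists (VertexPath (erange f)).
move=> /andP[/eqP fg pes].
by exists (EdgePath pes); rewrite //= fg leavitt_se.
Qed.

(** * The homogeneous components *)

Local Notation T := (leavitt_component F).

Lemma component0 k : T k 0.
Proof.
pose no_path (i : 'I_0) : gpath E := False_rect _ (notF (ltn_ord i)).
exists 0, (fun=> 0), no_path, no_path; split; first by case.
by rewrite big_ord0.
Qed.

Lemma componentD k x y : T k x -> T k y -> T k (x + y).
Proof.
move=> [m [l [a [b [ab ->]]]]] [n [l' [a' [b' [ab' ->]]]]].
pose cat X (f : 'I_m -> X) (g : 'I_n -> X) i : X :=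
  match fintype.split i with inl i => f i | inr i => g i end.
exists (m + n)%N, (cat _ l l'), (cat _ a a'), (cat _ b b'); split.
  by move=> i; rewrite /cat; case: fintype.split.
rewrite big_split_ord /=; congr (_ + _); apply: eq_bigr => i _.
  by rewrite /cat (unsplitK (inl i)).
by rewrite /cat (unsplitK (inr i)).
Qed.

Lemma componentZ k l x : T k x -> T k (l *: x).
Proof.
move=> [m [l' [a [b [ab ->]]]]].
exists m, (fun i => l * l' i), a, b; split=> //.
by rewrite scaler_sumr; apply: eq_bigr => i _; rewrite scalerA.
Qed.

Lemma componentB k x y : T k x -> T k y -> T k (x - y).
Proof.
by move=> Tx Ty; rewrite -scaleN1r; apply: componentD => //; apply: componentZ.
Qed.

Lemma component_monomial k p q :
  (gpath_length p)%:Z - (gpath_length q)%:Z = k ->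
  T k (path_elt F p ** ghost_elt F q).
Proof.
move=> pq; exists 1, (fun=> 1), (fun=> p), (fun=> q); split=> //.
by rewrite big_ord1 scale1r.
Qed.

Lemma component_ind k (Q : L -> Prop) :
  Q 0 -> (forall x y, Q x -> Q y -> Q (x + y)) ->
  (forall l x, Q x -> Q (l *: x)) ->
  (forall p q, (gpath_length p)%:Z - (gpath_length q)%:Z = k ->
    Q (path_elt F p ** ghost_elt F q)) ->
  forall x, T k x -> Q x.
Proof.
move=> Q0 QD QZ Qpq x [m [l [a [b [ab ->]]]]].
by elim/big_ind: _ => // i _; apply: QZ; apply: Qpq.
Qed.

Lemma component_vertex v : T 0 (fam_v F v).
Proof.
have := @component_monomial 0 (VertexPath v) (VertexPath v) erefl.
by rewrite /= (leavitt_vv HF) eqxx.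
Qed.

Lemma component_edge e : T 1 (fam_e F e).
Proof.
have := @component_monomial 1 (@EdgePath E e [::] isT)
  (VertexPath (erange e)) erefl.
by rewrite /= leavitt_er.
Qed.

Lemma component_ghost e : T (- 1) (fam_g F e).
Proof.
have := @component_monomial (- 1) (VertexPath (erange e))
  (@EdgePath E e [::] isT) erefl.
by rewrite /= leavitt_rg.
Qed.

Record graded_closed (X : int -> set L) : Prop := {
  graded0 : forall k, X k 0;
  gradedD : forall k x y, X k x -> X k y -> X k (x + y);
  gradedZ : forall k l x, X k x -> X k (l *: x);
  gradedM : forall j k x y, X j x -> X k y -> X (j + k) (x ** y);
  graded_vertex : forall v, X 0 (fam_v F v);
  graded_edge : forall e, X 1 (fam_e F e);
  graded_ghost : forall e, X (- 1) (fam_g F e)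
}.

(** The monomial [alpha beta^*] is a product of generators whose degrees add up
    to [|alpha| - |beta|], so any family with the closure properties of a
    graded subalgebra contains it in that degree.  This is what turns facts
    about generators into facts about components. *)
Lemma component_min X k : graded_closed X -> T k `<=` X k.
Proof.
move=> HX.
have Xpath p : X (gpath_length p)%:Z (path_elt F p).
  case: p => [v|e es pes] /=; first exact: graded_vertex.
  elim/last_ind: es {pes} => [|es f IH] /=; first exact: graded_edge.
  rewrite foldl_rcons size_rcons -addn1 PoszD.
  by apply: gradedM => //; exact: graded_edge.
have Xghost p : X (- (gpath_length p)%:Z) (ghost_elt F p).
  case: p => [v|e es pes] /=; first by rewrite oppr0; exact: graded_vertex.
  elim/last_ind: es {pes} => [|es f IH] /=; first exact: graded_ghost.
  rewrite foldl_rcons size_rcons -add1n PoszD opprD.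
  by apply: gradedM => //; exact: graded_ghost.
apply: component_ind; [exact: graded0|exact: gradedD|exact: gradedZ|].
by move=> p q <-; apply: gradedM.
Qed.

(** The elements that multiply each [T k] into [T (d + k)], on the left, form
    degree by degree such a family: closure under products is associativity,
    and a generator times [alpha beta^*] is again a monomial, or zero. *)
Lemma component_mul_closed :
  graded_closed (fun d => [set x | forall k y, T k y -> T (d + k) (x ** y)]).
Proof.
have gen d x : (forall p q, T (d + ((gpath_length p)%:Z - (gpath_length q)%:Z))
     (x ** (path_elt F p ** ghost_elt F q))) ->
    forall k y, T k y -> T (d + k) (x ** y).
  move=> xpq k; apply: component_ind => [|y z|l y|p q <-]; last exact: xpq.
  - by rewrite numulr0; exact: component0.
  - by rewrite numulDr; exact: componentD.
  - by rewrite -nuscalerAr; exact: componentZ.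
split=> /=.
- by move=> d k y _; rewrite numul0r; exact: component0.
- move=> d x x' Tx Tx' k y Ty; rewrite numulDl.
  by apply: componentD; [exact: Tx|exact: Tx'].
- by move=> d l x Tx k y Ty; rewrite -nuscalerAl; apply/componentZ/Tx.
- by move=> d d' x x' Tx Tx' k y Ty; rewrite -numulA -addrA; apply/Tx/Tx'.
- move=> v; apply: gen => p q; rewrite numulA add0r.
  rewrite (vertex_mul _ (source_mul_path p)); case: eqP => _.
    exact: component_monomial.
  by rewrite numul0r; exact: component0.
- move=> e; apply: gen => p q; rewrite numulA.
  case: (edge_mul_path e p) => [->|[p' lp' ->]].
    by rewrite numul0r; exact: component0.
  by apply: component_monomial; rewrite lp' -add1n PoszD addrA.
- move=> e; apply: gen => p q; rewrite numulA.
  case: (ghost_mul_path e p) => [->|[[-> lp]|[p' lp ->]]].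
  + by rewrite numul0r; exact: component0.
  + case: (ghost_mul_ghost e q) => [->|[q' lq' gq]]; first exact: component0.
    (* here alpha is a vertex and e^* beta^* = q'^*; the vertex r(e) serves as
       the real path in front of it *)
    rewrite -(leavitt_rg HF) -numulA gq.
    apply: (@component_monomial _ (VertexPath _)).
    by rewrite lq' lp /= !sub0r -add1n PoszD opprD.
  + apply: component_monomial.
    by rewrite lp -add1n PoszD -[1%N%:Z + _ - _]addrA addKr.
Qed.

Lemma componentM j k x y : T j x -> T k y -> T (j + k) (x ** y).
Proof. by move=> Tx; apply: (component_min component_mul_closed Tx). Qed.

(** * Spanning and local units *)

Hypothesis HG : generated_by F.

(** Quantifying over all larger lists [t] lets two elements share the sum over
    the concatenation of their lists, so that the elements having such a unit
    form a subalgebra. *)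
Lemma local_unit x : exists s : seq (vertex E),
  forall t, uniq t -> {subset s <= t} -> x ** (\sum_(v <- t) fam_v F v) = x.
Proof.
set S := [set x | exists s : seq (vertex E),
  forall t, uniq t -> {subset s <= t} -> x ** (\sum_(v <- t) fam_v F v) = x].
have Sgen y v : y ** fam_v F v = y -> S y.
  move=> yv; exists [:: v] => t ut /(_ v (mem_head _ _)) vt.
  rewrite numul_sumr (bigD1_seq v) //= yv -[RHS]addr0; congr (_ + _).
  apply: big1 => w /negPf wv.
  by rewrite -yv -numulA (leavitt_vv HF) eq_sym wv numulr0.
suff ST : S = setT by have : S x by rewrite ST.
apply: HG; [split|..] => /=.
- by exists [::] => t _ _; rewrite numul0r.
- move=> y z [s sy] [s' sz]; exists (s ++ s') => t ut st.
  by rewrite numulBl sy ?sz// => v vs; apply: st; rewrite mem_cat vs ?orbT.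
- by move=> l y [s sy]; exists s => t ut st; rewrite -nuscalerAl sy.
- by move=> y z _ [s sz]; exists s => t ut st; rewrite -numulA sz.
- by move=> v; apply: (Sgen _ v); rewrite (leavitt_vv HF) eqxx.
- by move=> e; apply: (Sgen _ (erange e)); exact: leavitt_er.
- by move=> e; apply: (Sgen _ (esource e)); exact: leavitt_gs.
Qed.

Lemma vertices_faithful x y :
  (forall v, x ** fam_v F v = y ** fam_v F v) -> x = y.
Proof.
move=> xy; apply/eqP; rewrite -subr_eq0; apply/eqP.
have [s xs] := local_unit (x - y).
rewrite -(xs (undup s)) ?undup_uniq// => [|v]; last by rewrite mem_undup.
by rewrite numul_sumr big1// => v _; rewrite numulBl xy subrr.
Qed.

(** It suffices that the smallest additive subgroup [S] containing the
    components is a subalgebra.  Closure of [S] under products is obtained by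
    induction on each factor in turn, the base case being [componentM]. *)
Lemma components_span (Q : set L) :
  Q 0 -> (forall x y, Q x -> Q y -> Q (x - y)) -> (forall k, T k `<=` Q) ->
  Q = setT.
Proof.
pose C (Q : set L) := Q 0 /\ forall x y, Q x -> Q y -> Q (x - y).
move=> Q0 QB TQ; pose S := smallest C (\bigcup_k T k).
have S0 : S 0 by move=> Q' [[]].
have SB x y : S x -> S y -> S (x - y).
  move=> Sx Sy M CM; apply: (CM.1.2); [exact: (Sx M CM)|exact: (Sy M CM)].
have TS k x : T k x -> S x by move=> Tx Q' [_ TQ']; apply: TQ'; exists k.
have SQ x : S x -> Q x by apply; split; [split|move=> y [k _]; exact: (TQ k)].
have Sind (P : set L) : P 0 -> (forall x y, P x -> P y -> P (x - y)) ->
    (forall k x, T k x -> P x) -> forall x, S x -> P x.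
  by move=> P0 PB TP x; apply; split; [split|move=> y [k _]; exact: (TP k)].
apply/seteqP; split=> // x _; apply: SQ.
suff -> : S = setT by [].
apply: HG => {x}; [split=> //|..].
- move=> l x; move: x; apply: (Sind _) => [|x y Sx Sy|k x Tx].
  + by rewrite scaler0.
  + by rewrite scalerBr; exact: SB.
  + by apply: (TS k); exact: componentZ.
- move=> x y Sx; move: x Sx y; apply: (Sind _) => [y _|x x' Sx Sx' y Sy|j x Tx].
  + by rewrite numul0r.
  + by rewrite numulBl; apply: SB; [exact: Sx|exact: Sx'].
  + apply: (Sind _) => [|y y' Sy Sy'|k y Ty].
    * by rewrite numulr0.
    * by rewrite numulBr; exact: SB.
    * by apply: (TS (j + k)); exact: componentM.
- by move=> v; apply: (TS 0); exact: component_vertex.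
- by move=> e; apply: (TS 1); exact: component_edge.
- by move=> e; apply: (TS (- 1)); exact: component_ghost.
Qed.

(** * Decomposition into homogeneous components *)

Definition decomposition (x : L) (x_ : int -> L) :=
  [/\ forall k, T k (x_ k), finite_set [set k | x_ k != 0]
    & x = \sum_(k \in [set: int]) x_ k].

Lemma decomposition_exists x : exists x_, decomposition x x_.
Proof.
suff all_x : [set x | exists x_, decomposition x x_] = setT.
  by have : [set: L] x by []; rewrite -all_x.
apply: components_span => [|_ _ [x_ [Tx fx ->]] [y_ [Ty fy ->]]|k y Tx].
- have z0 (k : int) : k \notin [::] -> (cst 0 : int -> L) k = 0 by [].
  exists (cst 0); split=> [k||]; first exact: component0.
    exact: (finite_support_of_seq z0).
  by rewrite (fsum_seq _ z0)// big_nil.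
- have [rx xr] := seq_of_finite_support fx.
  have [ry yr] := seq_of_finite_support fy.
  have x0 k : k \notin undup (rx ++ ry) -> x_ k = 0.
    by rewrite mem_undup mem_cat negb_or => /andP[/xr].
  have y0 k : k \notin undup (rx ++ ry) -> y_ k = 0.
    by rewrite mem_undup mem_cat negb_or => /andP[_ /yr].
  have xy0 k : k \notin undup (rx ++ ry) -> x_ k - y_ k = 0.
    by move=> kr; rewrite x0// y0// subrr.
  exists (fun k => x_ k - y_ k); split=> [k||]; first exact: componentB.
    exact: (finite_support_of_seq xy0).
  rewrite (fsum_seq _ x0) ?undup_uniq// (fsum_seq _ y0) ?undup_uniq//.
  by rewrite (fsum_seq _ xy0) ?undup_uniq// sumrB.
- pose x_ j := if j == k then y else 0.
  have z0 j : j \notin [:: k] -> x_ j = 0.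
    by rewrite mem_seq1 /x_ => /negPf ->.
  exists x_; split=> [j||]; last first.
  + by rewrite (fsum_seq _ z0)// big_seq1 /x_ eqxx.
  + exact: (finite_support_of_seq z0).
  + by rewrite /x_; case: eqP => [->|_] //; exact: component0.
Qed.

(** Applied to a sequence concentrated in degree [0], the operator
    [x_ k t^k] only contributes to degree [k]: this is how [phi] separates the
    components of [x]. *)
Lemma decomposition_coefficient (phi : {linear L -> endo (int -> L)}) x x_ :
  (forall k y, T k y -> phi y = laurent y k) -> decomposition x x_ ->
  forall n v, phi x (fun k => if k == 0 then fam_v F v else 0) n =
    x_ n ** fam_v F v.
Proof.
move=> phiE [Tx fx ->] n v; have [r xr] := seq_of_finite_support fx.
have x0 k : k \notin undup (n :: r) -> x_ k = 0.
  by rewrite mem_undup in_cons negb_or => /andP[_ /xr].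
rewrite (fsum_seq (undup_uniq _) x0) linear_sum.
rewrite (eq_bigr (fun k => laurent (x_ k) k)) => [|k _]; last exact: phiE.
rewrite laurent_sum (bigD1_seq n) ?undup_uniq//; last first.
  by rewrite mem_undup mem_head.
rewrite /= subrr eqxx big1 ?addr0// => k kn.
by rewrite subr_eq0 eq_sym (negPf kn) numulr0.
Qed.

(** Feeds [component_min]: a homomorphism given by Laurent monomials on the
    generators is given by them on every component. *)
Lemma laurent_graded_closed (phi : {linear L -> endo (int -> L)}) :
  [/\ forall x y, phi (x ** y) = phi x ** phi y,
      forall v, phi (fam_v F v) = laurent (fam_v F v) 0,
      forall e, phi (fam_e F e) = laurent (fam_e F e) 1
    & forall e, phi (fam_g F e) = laurent (fam_g F e) (- 1)] ->
  graded_closed (fun k => [set x | phi x = laurent x k]).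
Proof.
move=> [phiM phiv phie phig]; split=> //=.
- by move=> k; rewrite linear0 laurent0.
- by move=> k x y px py; rewrite linearD px py laurentD.
- by move=> k l x px; rewrite laurentZ -px linearZ.
- by move=> j k x y px py; rewrite phiM px py laurentM.
Qed.

End LeavittPathAlgebra.

Theorem proposition4p7 (E : graph) (R : comPzRingType)
    (L : nonUnitalAlgType R) (F : gen_family E L)
    (HL : is_leavitt_path_algebra F) :
  is_Zgrading (leavitt_component F).
Proof.
have [HF HG Huniv] := HL.
split=> [k|x|]; last by move=> j k x y; exact: componentM.
  by split; [exact: component0|exact: componentB].
have [x_ dx] := decomposition_exists HF HG x; exists x_; split=> // y_ dy.
have [phi /laurent_graded_closed phi_closed] := Huniv _ _ (laurent_family HF).
have phiE k y : leavitt_component F k y -> phi y = laurent y k.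
  exact: (component_min phi_closed).
apply/funext => n; apply: (vertices_faithful HF HG) => v.
rewrite -(decomposition_coefficient phiE dx).
by rewrite -(decomposition_coefficient phiE dy).
Qed.
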